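(* Let $q\geq 2$, $k\geq 2$ and $d\geq k$ be integers, $I$ an instance of $\mathsf{k\,CSP\!-\!q}$ with $n$ variables, and $x\in\Sigma_q^n$ a solution of $I$. Then, for $I$, the highest differential ratio reached on $B^d(x)$ is at least $\delta(n,d,k)$ (where $n\geq d$), and the highest differential ratio reached on $\tilde{B}^d(x)$ is at least $\delta(\lfloor n(q-1)/q\rfloor,d,k)$ (where $\lfloor n(q-1)/q\rfloor\geq d$).
   Context: Let $\Sigma_q=\{0,1,\ldots,q-1\}$, with arithmetic modulo $q$ (componentwise on vectors), and $[n]=\{1,\ldots,n\}$; for $a\in\Sigma_q$, $\mathbf{a}=(a,\ldots,a)$. CSPs. An instance $I$ of $\mathsf{k\,CSP\!-\!q}$ with $n$ variables consists of an integer $m\ge 1$, a goal (maximize or minimize) and, for each $i\in[m]$, a weight $w_i>0$, an integer $1\le k_i\leq \min\{k,n\}$, a strictly increasing sequence $J_i=(i_1,\ldots,i_{k_i})$ of indices of $[n]$, and a function $P_i:\Sigma_q^{k_i}\to\mathbb{R}$. Solutions are vectors $x\in\Sigma_q^n$, with value $v(I,x)=\sum_{i=1}^m w_iP_i(x_{i_1},\ldots,x_{i_{k_i}})$. $\mathrm{opt}(I)$ and $\mathrm{wor}(I)$ are the best and worst solution values (maximum and minimum of $v(I,\cdot)$ if maximizing, minimum and maximum if minimizing). The differential ratio of $y$ on $I$ is $(v(I,y)-\mathrm{wor}(I))/(\mathrm{opt}(I)-\mathrm{wor}(I))$ (considered when $\mathrm{opt}(I)\neq\mathrm{wor}(I)$).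 Neighborhoods. $B^d(x)$ is the set of $y\in\Sigma_q^n$ at Hamming distance at most $d$ from $x$, and $\tilde{B}^d(x)=\bigcup_{a=0}^{q-1}B^d(x+\mathbf{a})$. Array pairs. For a Boolean array $M$ (a multiset of words of $\{0,1\}^n$, its rows), $\mu^M(u)$ is the fraction of rows equal to $u$. For integers $n\geq d\geq k\geq 1$, an $(n,d)$-cover pair of arrays (CPA) of strength $k$ is a pair $(\Psi,\Phi)$ of Boolean arrays with $n$ columns and the same number of rows such that: (1) $\Phi$ contains at least one row of the form $(1,\ldots,1)$; (2) each row of $\Psi$ contains at most $d$ ones; (3) $\mu^\Psi-\mu^\Phi$ is balanced $k$-wise independent, i.e., for all columns $j_1<\cdots<j_k$ and all $v\in\{0,1\}^k$, the rows of $\Psi$ and of $\Phi$ restricted to these columns coincide with $v$ equally often. For integers $R\geq R^*>0$, $\Delta(R,R^*,n,d,k)$ is the set of such pairs in which the arrays have $R$ rows each and $(1,\ldots,1)$ occurs exactly $R^*$ times in $\Phi$. $\delta(n,d,k)$ is the largest number $\delta$ such that $\Delta(R,R^*,n,d,k)\neq\emptyset$ for some integers $R\geq R^*>0$ with $R^*/R=\delta$. *)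

(* Defs.v *)
From HB Require Import structures.
From mathcomp Require Import boolp classical_sets reals.
From mathcomp Require Import all_boot all_order all_algebra.
Set Implicit Arguments.
Unset Strict Implicit.
Unset Printing Implicit Defensive.
Import Order.TTheory GRing.Theory Num.Theory.
Local Open Scope ring_scope.

(* The alphabet is ['Z_q], whose carrier is {0, ..., q-1} only for [1 < q]. *)
Definition solution (q n : nat) := {ffun 'I_n -> 'Z_q}.

Record constraint (R : realType) (q k n : nat) := Constraint {
  weight : R;
  weight_gt0 : 0 < weight;
  arity : nat;
  arity_bounds : (0 < arity <= minn k n)%N;
  support : 'I_arity -> 'I_n;
  support_increasing : {homo support : i j / (i < j)%N};
  payoff : {ffun 'I_arity -> 'Z_q} -> R }.

Inductive goal := Maximize | Minimize.

Record csp (R : realType) (q k n : nat) := Csp {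
  csp_goal : goal;
  csp_size : nat;
  csp_size_gt0 : (0 < csp_size)%N;
  csp_constraint : 'I_csp_size -> constraint R q k n }.

Arguments support {R q k n} c _.
Arguments payoff {R q k n} c _.
Arguments csp_constraint {R q k n} c _.

Section Values.
Variables (R : realType) (q k n : nat) (I : csp R q k n).

Definition value (x : solution q n) : R :=
  \sum_(i < csp_size I)
    let c := csp_constraint I i in
    weight c * payoff c [ffun j => x (support c j)].

(* The starting point [0] of the arg max/min plays no role in the extremum. *)
Definition max_value : R := value [arg max_(x > (0 : solution q n)) value x]%O.
Definition min_value : R := value [arg min_(x < (0 : solution q n)) value x]%O.

Definition opt : R := if csp_goal I is Maximize then max_value else min_value.
Definition wor : R := if csp_goal I is Maximize then min_value else max_value.

Definition diff_ratio (y : solution q n) : R :=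
  (value y - wor) / (opt - wor).

(* The maximum of the ratio over [A], for [A] containing [x]. *)
Definition highest_ratio (x : solution q n) (A : {set solution q n}) : R :=
  diff_ratio [arg max_(y > x in A) diff_ratio y]%O.

End Values.

Definition hamming (q n : nat) (x y : solution q n) : nat :=
  #|[set i | x i != y i]|.

Definition ball (q n d : nat) (x : solution q n) : {set solution q n} :=
  [set y | (hamming x y <= d)%N].

Definition shifted_ball (q n d : nat) (x : solution q n) :
    {set solution q n} :=
  \bigcup_(a : 'Z_q) ball d (x + [ffun=> a]).

Definition word (n : nat) := {ffun 'I_n -> bool}.

(* An array is the list of its rows; only multiplicities of rows are ever
   used, so the order of the rows is irrelevant. *)
Definition array (n : nat) := seq (word n).

Definition ones_word (n : nat) : word n := [ffun=> true].

Definition nb_ones (n : nat) (u : word n) : nat := #|[set j | u j]|.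

(* [u], restricted to the columns [J 0 < ... < J k.-1], is the word [v]. *)
Definition coincides (n k : nat) (J : 'I_k -> 'I_n) (v : word k) (u : word n) : bool :=
  [forall i : 'I_k, u (J i) == v i].

(* For arrays with equally many rows, comparing numbers of rows amounts to
   comparing frequencies. *)
Definition balanced (n k : nat) (Psi Phi : array n) : Prop :=
  forall J : 'I_k -> 'I_n, {homo J : i j / (i < j)%N} ->
  forall v : word k, count (coincides J v) Psi = count (coincides J v) Phi.

Definition cpa (n d k : nat) (Psi Phi : array n) : Prop :=
  [/\ size Psi = size Phi,
      ones_word n \in Phi,
      all (fun u => nb_ones u <= d)%N Psi
    & balanced k Psi Phi].

Definition Delta (R Rs n d k : nat) : set (array n * array n) :=
  [set A | [/\ cpa d k A.1 A.2, size A.1 = R, size A.2 = R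
             & count_mem (ones_word n) A.2 = Rs]]%classic.
Arguments Delta : clear implicits.

Definition cpa_ratios (R : realType) (n d k : nat) : set R :=
  [set r | exists N Ns : nat,
     [/\ (0 < Ns <= N)%N, (Delta N Ns n d k !=set0)%classic
       & r = Ns%:R / N%:R]]%classic.
Arguments cpa_ratios : clear implicits.

(* The supremum is a maximum: see [delta_is_largest]. *)
Definition delta (R : realType) (n d k : nat) : R := sup (cpa_ratios R n d k).

Section Attained.
Local Open Scope nat_scope.

(* Dickson's lemma: pointwise minimal count vectors form a finite set. *)
Lemma dickson (X T : eqType) (cnt : X -> T -> nat) (s : seq T) (S : X -> Prop) :
  exists L : seq X, (forall x, x \in L -> S x) /\
    forall y, S y -> exists2 x, x \in L & forall t, t \in s -> cnt x t <= cnt y t.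
Proof.
elim: s S => [|t s IH] S.
  have [[x Sx]|nS] := pselect (exists x, S x).
    exists [:: x]; split=> [y|y _]; first by rewrite inE => /eqP->.
    by exists x; rewrite ?mem_head.
  by exists [::]; split=> // y Sy; case: nS; exists y.
have [L0 [L0S L0P]] := IH S.
pose m := \max_(x <- L0) cnt x t.
have: exists L : seq X, (forall x, x \in L -> S x) /\
    forall y, S y -> cnt y t < m ->
    exists2 x, x \in L & forall u, u \in t :: s -> cnt x u <= cnt y u.
  elim: m => [|m [L [LS LP]]]; first by exists [::].
  have [L1 [L1S L1P]] := IH (fun x => S x /\ cnt x t = m).
  exists (L ++ L1); split=> [x|y Sy].
    by rewrite mem_cat => /orP[/LS//|/L1S[]].
  rewrite ltnS leq_eqVlt => /orP[/eqP ym|/(LP _ Sy)[x xL xP]]; last first.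
    by exists x; rewrite ?mem_cat ?xL.
  have [x xL xP] := L1P y (conj Sy ym).
  exists x; first by rewrite mem_cat xL orbT.
  move=> u; rewrite inE => /orP[/eqP->|/xP//].
  by rewrite ym; have [_ ->] := L1S _ xL.
case=> L [LS LP]; exists (L0 ++ L); split=> [x|y Sy].
  by rewrite mem_cat => /orP[/L0S|/LS].
have [lt_ym|le_my] := ltnP (cnt y t) m.
  by have [x xL xP] := LP _ Sy lt_ym; exists x; rewrite ?mem_cat ?xL ?orbT.
have [x xL xP] := L0P _ Sy; exists x; first by rewrite mem_cat xL.
move=> u; rewrite inE => /orP[/eqP->|/xP//].
by apply: leq_trans le_my; rewrite /m (big_rem x) //= leq_maxl.
Qed.

Lemma perm_subtract (T : eqType) (s r : seq T) :
  (forall x, count_mem x r <= count_mem x s) -> exists t, perm_eq s (r ++ t).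
Proof.
move/count_subseqP => [r' /perm_to_subseq[t st] rr'].
by exists t; rewrite (permPl st) perm_cat2r perm_sym.
Qed.

(* Predicates on words that depend on at most [k] columns. *)
Definition junta n k (P : pred (word n)) : Prop :=
  forall K : {set 'I_n}, #|K| = k.+1 -> exists2 e, e \in K &
    forall u u' : word n, (forall j, j != e -> u j = u' j) -> P u = P u'.

Lemma junta_predT n k : @junta n k xpredT.
Proof.
move=> K cK; have /card_gt0P[e eK] : 0 < #|K| by rewrite cK.
by exists e.
Qed.

Lemma junta_coincides n k (J : 'I_k -> 'I_n) v : junta k (coincides J v).
Proof.
move=> K cK; have : ~~ (K \subset [set J i | i : 'I_k]).
  apply/negP => /subset_leq_card; rewrite cK leqNgt ltnS.
  by rewrite (leq_trans (leq_imset_card _ _)) // card_ord.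
case/subsetPn => e eK eJ; exists e => // u u' uu'.
apply: eq_forallb => i; rewrite uu' //.
by apply: contraNneq eJ => <-; rewrite imset_f.
Qed.

Definition erase n (w : word n) (T : {set 'I_n}) : word n :=
  [ffun j => w j && (j \notin T)].

Lemma erase_parity n k (w : word n) (K : {set 'I_n}) (P : pred (word n)) :
  #|K| = k.+1 -> junta k P ->
  \sum_(T : {set 'I_n} | (T \subset K) && odd #|T|) P (erase w T) =
  \sum_(T : {set 'I_n} | (T \subset K) && ~~ odd #|T|) P (erase w T).
Proof.
move=> cK /(_ _ cK)[e eK eP].
pose h (T : {set 'I_n}) := if e \in T then T :\ e else e |: T.
have hK : involutive h.
  move=> T; rewrite /h; have [eT|eT] := boolP (e \in T).
    by rewrite setD11 setD1K.
  by rewrite setU11 setU1K.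
rewrite (reindex_inj (inv_inj hK)); apply: eq_big => [T|T _].
  rewrite /h; have [eT|eT] := boolP (e \in T).
    by rewrite [in RHS](cardsD1 e T) eT /= negbK subDset setUC
               (setUidPl _) ?sub1set.
  by rewrite cardsU1 eT /= subUset sub1set eK.
congr nat_of_bool; apply: eP => j je; rewrite !ffunE; congr (_ && ~~ _).
by rewrite /h; case: ifP => _; rewrite !inE (negPf je).
Qed.

Lemma count_erase n (w : word n) (Q : pred {set 'I_n}) (P : pred (word n)) :
  count P [seq erase w T | T <- enum Q] = \sum_(T | Q T) P (erase w T).
Proof.
rewrite count_map -sum1_count big_mkcond /= big_enum /=.
by apply: eq_bigr => T _; case: (P _).
Qed.

Lemma nb_ones_erase n (w : word n) (T : {set 'I_n}) e :
  e \in T -> w e -> nb_ones (erase w T) < nb_ones w.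
Proof.
move=> eT we; apply: proper_card; apply/properP; split.
  by apply/subsetP => j; rewrite !inE ffunE => /andP[].
by exists e; rewrite !inE ?ffunE ?eT ?andbF.
Qed.

Lemma low_weight_cover n k (w : word n) :
  exists Psi Phi : array n, all (fun u => nb_ones u <= k) Psi /\
    forall P, junta k P -> count P Psi = P w + count P Phi.
Proof.
have [m] := ubnP (nb_ones w); elim: m w => // m IH w; rewrite ltnS => wm.
have [wk|] := leqP (nb_ones w) k.
  exists [:: w], [::]; split=> [|P _]; first by rewrite /= wk.
  by rewrite /= addn0.
case/card_geqP => t [ut st tw]; pose K : {set 'I_n} := [set j in t].
have cK : #|K| = k.+1 by rewrite cardsE (card_uniqP ut).
pose podd (T : {set 'I_n}) := (T \subset K) && odd #|T|.
pose peven (T : {set 'I_n}) := (T \subset K) && ~~ odd #|T|.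
have below : forall u, u \in [seq erase w T | T <- enum podd] -> nb_ones u < m.
  move=> u /mapP[T]; rewrite mem_enum => /andP[TK oT] ->.
  have /card_gt0P[e eT] : 0 < #|T| by case: #|T| oT.
  apply: leq_trans wm; apply: (@nb_ones_erase _ _ _ e) => //.
  have := subsetP TK e eT; rewrite inE => /tw.
  by rewrite inE.
have [Psi [Phi [low PP]]] : exists Psi Phi : array n,
    all (fun u => nb_ones u <= k) Psi /\
    forall P, junta k P -> count P Psi =
      count P [seq erase w T | T <- enum podd] + count P Phi.
  move: [seq erase w T | T <- enum podd] below.
  elim=> [|u s IHs] below.
    by exists [::], [::].
  have [|Psi [Phi [low PP]]] := IHs.
    by move=> u' u's; apply: below; rewrite inE u's orbT.
  have [Psi1 [Phi1 [low1 PP1]]] := IH u (below _ (mem_head _ _)).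
  exists (Psi1 ++ Psi), (Phi1 ++ Phi); split=> [|P jP].
    by rewrite all_cat low1.
  by rewrite !count_cat PP1 // PP //= addnACA.
pose peven' (T : {set 'I_n}) := peven T && (T != set0).
exists Psi, ([seq erase w T | T <- enum peven'] ++ Phi); split=> // P jP.
rewrite PP // count_cat addnA; congr (_ + _).
rewrite !count_erase (erase_parity w cK jP) (bigD1 set0) /=; last first.
  by rewrite sub0set cards0.
congr (nat_of_bool (P _) + _).
by apply/ffunP => j; rewrite ffunE inE andbT.
Qed.

Definition weak_cpa n d k (A : array n * array n) : Prop :=
  [/\ size A.1 = size A.2, all (fun u => nb_ones u <= d) A.1
    & balanced k A.1 A.2].

Definition pair_count n (A : array n * array n) (t : bool * word n) : nat :=
  count_mem t.2 (if t.1 then A.1 else A.2).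

Lemma weak_cpa_subtract n d k (A B : array n * array n) :
  weak_cpa d k A -> weak_cpa d k B ->
  (forall t, pair_count B t <= pair_count A t) ->
  exists C, [/\ weak_cpa d k C, perm_eq A.1 (B.1 ++ C.1)
              & perm_eq A.2 (B.2 ++ C.2)].
Proof.
move=> [sA oA bA] [sB oB bB] BA.
have [C1 p1] := perm_subtract (fun x => BA (true, x)).
have [C2 p2] := perm_subtract (fun x => BA (false, x)).
exists (C1, C2); split=> //; split=> /=.
- move: sA; rewrite (perm_size p1) (perm_size p2) !size_cat sB.
  by move/addnI.
- by move: oA; rewrite (perm_all _ p1) all_cat => /andP[].
- move=> J hJ v; have := bA J hJ v.
  by rewrite (permP p1) (permP p2) !count_cat (bB J hJ) => /addnI.
Qed.

Lemma weak_cpa_exists n d k : k <= d ->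
  exists2 A : array n * array n, weak_cpa d k A & ones_word n \in A.2.
Proof.
move=> kd; have [Psi [Phi [low PP]]] := low_weight_cover k (ones_word n).
exists (Psi, ones_word n :: Phi); rewrite ?mem_head //; split=> /=.
- by rewrite -(count_predT Psi) (PP _ (@junta_predT n k)) count_predT.
- by apply: sub_all low => u /leq_trans; apply.
- by move=> J _ v; rewrite (PP _ (junta_coincides J v)).
Qed.

End Attained.

Lemma seq_argmax (R : realType) (X : eqType) (f : X -> R) (s : seq X) x0 :
  x0 \in s -> exists2 x, x \in s & forall y, y \in s -> f y <= f x.
Proof.
elim: s x0 => // a [|b s] IH x0 _.
  by exists a => [|y]; rewrite inE // => /eqP->.
have [x xs xP] := IH b (mem_head _ _).
have [ax|/ltW xa] := leP (f a) (f x).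
  exists x; first by rewrite inE xs orbT.
  by move=> y; rewrite inE => /orP[/eqP->|/xP].
exists a; first exact: mem_head.
by move=> y; rewrite inE => /orP[/eqP->//|/xP/le_trans]; apply.
Qed.

Lemma delta_is_largest (R : realType) (n d k : nat) : (k <= d)%N ->
  cpa_ratios R n d k (delta R n d k) /\
  forall r, cpa_ratios R n d k r -> r <= delta R n d k.
Proof.
move=> kd.
pose num (A : array n * array n) := count_mem (ones_word n) A.2.
pose den (A : array n * array n) := size A.2.
pose ratio A : R := (num A)%:R / (den A)%:R.
have [L [LS LP]] := dickson (@pair_count n) (enum {: bool * word n})
  (fun A => weak_cpa d k A /\ (0 < den A)%N).
have {LP} LP A : weak_cpa d k A -> (0 < den A)%N ->
    exists2 B, B \in L & forall t, (pair_count B t <= pair_count A t)%N.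
  move=> wA dA; have [B BL BP] := LP A (conj wA dA).
  by exists B => // t; apply: BP; rewrite mem_enum.
have [A0 wA0 A01] := weak_cpa_exists n kd.
have nA0 : (0 < num A0)%N by rewrite -has_count has_pred1.
have dA0 : (0 < den A0)%N by apply: leq_trans nA0 (count_size _ _).
have [B0 B0L _] := LP _ wA0 dA0.
have [M ML MP] := seq_argmax ratio B0L.
have ratio_ge0 A : 0 <= ratio A by rewrite divr_ge0.
have main A : weak_cpa d k A -> (num A)%:R <= ratio M * (den A)%:R.
  have [m] := ubnP (den A); elim: m A => // m IH A; rewrite ltnS => Am wA.
  have [dA|dA] := posnP (den A).
    have: (num A <= den A)%N by exact: count_size.
    by rewrite dA leqn0 => /eqP->; rewrite mulr0.
  have [B BL BA] := LP _ wA dA; have [wB dB] := LS _ BL.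
  have [C [wC _ p2]] := weak_cpa_subtract wA wB BA.
  have -> : num A = (num B + num C)%N by rewrite /num (permP p2) count_cat.
  have denA : den A = (den B + den C)%N by rewrite /den (perm_size p2) size_cat.
  rewrite denA !natrD mulrDr lerD //.
    by rewrite -ler_pdivrMr ?ltr0n // MP.
  by apply: IH => //; apply: leq_trans Am; rewrite denA -{1}[den C]add0n ltn_add2r.
have [wM dM] := LS _ ML.
have nM : (0 < num M)%N.
  have := main _ wA0; rewrite lt0n; apply: contraTneq => nM0.
  by rewrite /ratio nM0 mul0r mul0r -ltNge ltr0n.
have inM : cpa_ratios R n d k (ratio M).
  exists (den M), (num M); split=> //; first by rewrite nM count_size.
  exists M; have [sM oM bM] := wM; split=> //; split=> //.
  by rewrite -has_pred1 has_count.
have ubM r : cpa_ratios R n d k r -> r <= ratio M.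
  move=> [N [Ns [/andP[Ns0 NsN] [A [[sA _ oA bA] _ sN cN]] ->]]].
  rewrite ler_pdivrMr ?ltr0n ?(leq_trans Ns0) // -cN -sN.
  by apply: main; split.
suff -> : delta R n d k = ratio M by [].
apply/le_anti/andP; split; first by apply: ge_sup; [exists (ratio M)|].
by apply: ub_le_sup => //; exists (ratio M).
Qed.

(* Main.v *)
Require Import Defs.
From mathcomp Require Import all_boot all_order all_algebra.
From mathcomp Require Import reals.
Set Implicit Arguments.
Unset Strict Implicit.
Unset Printing Implicit Defensive.
Import Order.TTheory GRing.Theory Num.Theory.
Local Open Scope ring_scope.

(** Fix an optimal solution [xs] and a base solution [z]. A Boolean word [u]
    selects the coordinates at which [z] is overwritten by [xs]; call the
    result a hybrid. A constraint reads at most [k] coordinates, so as a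
    function of [u] its payoff only sees [k] columns, and two arrays that are
    balanced [k]-wise give it the same total ([sum_depends_on]). Hence the
    hybrids selected by [Psi] and by [Phi] have the same total value, and, the
    ratio being affine in the value, the same total differential ratio
    ([sum_diff_ratio_hybrid]). On the side of [Phi], each of the [R*] all-one
    rows gives [xs], of ratio 1, and the other rows contribute at least 0; on
    the side of [Psi], each row changes at most [d] coordinates of [z] and thus
    gives an element of the ball. So the best of the [R] hybrids of [Psi] has
    ratio at least [R*/R] ([cpa_ratio_le_highest]), and [delta] is one of these
    quotients.

    The number of columns needed is only the number of coordinates where [z]
    and [xs] differ. Around [x] itself these may be all [n] coordinates. When
    all shifts [x + a] are available as bases, every coordinate agrees with
    [xs] for exactly one [a], so some shift agrees with [xs] on at least [n/q]
    coordinates ([close_shift]), and [n(q-1)/q] columns, rounded down, are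
    enough. *)

(** * Subsets of prescribed size *)

Lemma superset_of_card (T : finType) (A : {set T}) (m : nat) :
  (#|A| <= m <= #|T|)%N -> exists2 B : {set T}, A \subset B & #|B| = m.
Proof.
case/andP=> /subnKC <-; elim: (m - #|A|)%N => [|p IH] lt_pT.
  by exists A; rewrite ?addn0.
have [|B AB cB] := IH; first by apply: leq_trans lt_pT; rewrite leq_add2l.
have /subsetPn[e _ eB] : ~~ ([set: T] \subset B).
  apply/negP => /subset_leq_card; rewrite cardsT cB leqNgt => /negP; apply.
  by apply: leq_trans lt_pT; rewrite addnS.
exists (e |: B); first by apply: subset_trans AB (subsetUr _ _).
by rewrite cardsU1 eB cB addnS.
Qed.

Lemma enumerate_increasing (m k : nat) (B : {set 'I_m}) : #|B| = k ->
  exists J : 'I_k -> 'I_m,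
    {homo J : i j / (i < j)%N} /\ (forall c, c \in B -> exists i, J i = c).
Proof.
move=> <-; exists enum_val; split=> [i j ij|c cB]; last first.
  by exists (enum_rank_in cB c); rewrite enum_rankK_in.
have x0 : 'I_m := enum_val i.
rewrite !(enum_val_nth x0) -!(nth_map x0 0%N val) -?cardE ?ltn_ord //.
have sB : sorted ltn (map val (enum B)).
  rewrite /enum_mem sorted_map -enumT.
  apply: sorted_filter; first by move=> a b c; apply: ltn_trans.
  by rewrite -sorted_map val_enum_ord iota_ltn_sorted.
apply: (sorted_ltn_nth ltn_trans) => //; rewrite inE size_map -cardE //.
Qed.

Lemma increasing_inj (m k : nat) (J : 'I_k -> 'I_m) :
  {homo J : i j / (i < j)%N} -> injective J.
Proof.
move=> J_incr i j eJ; apply: val_inj.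
by case: (ltngtP i j) => // /J_incr; rewrite eJ ltnn.
Qed.

(** * Balanced arrays and functions of few columns *)

Definition depends_on {m : nat} {T : Type} (S : {set 'I_m}) (F : word m -> T) :=
  forall u u' : word m, {in S, u =1 u'} -> F u = F u'.

(** The sum of [F] can be grouped by the restriction of the rows to [k]
    columns that contain [S]; balance equates the sizes of the groups. *)
Lemma sum_depends_on (R : realType) (m k : nat) (Psi Phi : array m)
    (S : {set 'I_m}) (F : word m -> R) :
  (#|S| <= k <= m)%N -> balanced k Psi Phi -> depends_on S F ->
  \sum_(u <- Psi) F u = \sum_(u <- Phi) F u.
Proof.
move=> Skm bal FS.
have [|B SB cB] := @superset_of_card _ S k; first by rewrite card_ord.
have [J [Jinc JB]] := enumerate_increasing cB.
pose restrict (u : word m) : word k := [ffun i => u (J i)].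
pose extend (v : word k) : word m :=
  [ffun c => [exists i, (J i == c) && v i]].
have Jinj := increasing_inj Jinc.
have FE u : F u = F (extend (restrict u)).
  apply: FS => c cS; have [i <-] := JB c (subsetP SB c cS).
  rewrite ffunE; apply/idP/existsP => [ui|[j /andP[/eqP/Jinj->]]].
    by exists i; rewrite eqxx ffunE.
  by rewrite ffunE.
have group (A : array m) : \sum_(u <- A) F u =
    \sum_(v : word k) (count (coincides J v) A)%:R * F (extend v).
  rewrite (eq_bigr _ (fun u _ => FE u)).
  rewrite (partition_big restrict xpredT) //=; apply: eq_bigr => v _.
  rewrite (eq_bigr (fun=> F (extend v))) => [|u /eqP->//].
  rewrite big_const_seq iter_addr_0 mulr_natl; congr (_ *+ _).
  apply: eq_count => u; apply/eqP/forallP => [<- i|uv].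
    by rewrite ffunE.
  by apply/ffunP => i; rewrite ffunE; apply/eqP.
by rewrite !group; apply: eq_bigr => v _; rewrite bal.
Qed.

(** * The differential ratio *)

Section DiffRatio.
Variables (R : realType) (q k n : nat) (I : csp R q k n).

Lemma min_value_le y : min_value I <= value I y.
Proof. by rewrite /min_value; case: arg_minP => // z _; apply. Qed.

Lemma max_value_ge y : value I y <= max_value I.
Proof. by rewrite /max_value; case: arg_maxP => // z _; apply. Qed.

Lemma diff_ratio_ge0 y : 0 <= diff_ratio I y.
Proof.
have le_m := min_value_le y; have le_M := max_value_ge y.
have le_mM := le_trans le_m le_M.
rewrite /diff_ratio /opt /wor; case: (csp_goal I).
  by rewrite divr_ge0 ?subr_ge0.
by rewrite -mulrNN -invrN !opprB divr_ge0 ?subr_ge0.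
Qed.

Lemma diff_ratio_opt : opt I != wor I -> exists xs, diff_ratio I xs = 1.
Proof.
move=> hI; have [xs xsE] : exists xs, value I xs = opt I.
  by rewrite /opt; case: (csp_goal I); eexists.
by exists xs; rewrite /diff_ratio xsE divff // subr_eq0.
Qed.

Lemma diff_ratio_le_highest x (A : {set solution q n}) y :
  x \in A -> y \in A -> diff_ratio I y <= highest_ratio I x A.
Proof.
by move=> xA yA; rewrite /highest_ratio; case: arg_maxP => // z _; apply.
Qed.

(** * Hybrids of two solutions *)

(** Words index the coordinates of solutions through [e], so that they can be
    shorter than solutions. *)
Definition hybrid (m : nat) (e : 'I_m -> 'I_n) (z xs : solution q n)
    (u : word m) : solution q n :=
  [ffun j => if [exists i, (e i == j) && u i] then xs j else z j].

Section Hybrid.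
Variables (m : nat) (e : 'I_m -> 'I_n) (z xs : solution q n).

Lemma hybrid_ones :
  (forall j, z j != xs j -> exists i, e i = j) ->
  hybrid e z xs (ones_word m) = xs.
Proof.
move=> cover; apply/ffunP => j; rewrite ffunE; case: existsP => // nj.
apply/eqP; apply: contra_notT nj => /cover[i ij].
by exists i; rewrite ij eqxx ffunE.
Qed.

Lemma hamming_hybrid u : (hamming z (hybrid e z xs u) <= nb_ones u)%N.
Proof.
apply: leq_trans (leq_imset_card e _); apply/subset_leq_card/subsetP => j.
rewrite inE ffunE; case: existsP => [[i /andP[/eqP<- ui] _]|]; last first.
  by rewrite eqxx.
by rewrite imset_f // inE.
Qed.

Hypothesis e_inj : injective e.

(** Injectivity of [e] keeps the locality: the value of a hybrid at one
    coordinate is controlled by at most one column, so a constraint of arity at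
    most [k] depends on at most [k] columns of the word. *)
Lemma sum_value_hybrid (Psi Phi : array m) : (k <= m)%N -> balanced k Psi Phi ->
  \sum_(u <- Psi) value I (hybrid e z xs u) =
  \sum_(u <- Phi) value I (hybrid e z xs u).
Proof.
move=> km bal; rewrite /value exchange_big [RHS]exchange_big /=.
apply: eq_bigr => i _; set c := csp_constraint I i.
pose S := [set l | e l \in [set Defs.support c j | j : 'I_(arity c)]].
apply: (@sum_depends_on _ _ k _ _ S) => //.
  rewrite km andbT -(card_imset _ e_inj).
  apply: (@leq_trans #|[set Defs.support c j | j : 'I_(arity c)]|).
    by apply/subset_leq_card/subsetP => _ /imsetP[l /[!inE] ? ->].
  apply: leq_trans (leq_imset_card _ _) _; rewrite card_ord.
  by have /andP[_] := arity_bounds c; rewrite leq_min => /andP[].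
move=> u u' uu'; congr (_ * payoff c _); apply/ffunP => j; rewrite !ffunE.
congr (if _ then _ else _); apply: eq_existsb => l.
by case: eqP => //= el; rewrite uu' // inE el imset_f.
Qed.

Lemma sum_diff_ratio_hybrid (Psi Phi : array m) : (k <= m)%N ->
  size Psi = size Phi -> balanced k Psi Phi ->
  \sum_(u <- Psi) diff_ratio I (hybrid e z xs u) =
  \sum_(u <- Phi) diff_ratio I (hybrid e z xs u).
Proof.
move=> km sz bal; rewrite -!mulr_suml !sumrB (sum_value_hybrid km bal).
by rewrite !big_const_seq !count_predT sz.
Qed.

(** The best row of [Psi] does at least as well as the average row, and the
    average is the same over [Phi], where the all-one rows alone contribute
    [R*/R]. *)
Lemma cpa_ratio_le_highest (d : nat) (x : solution q n)
    (A : {set solution q n}) (r : R) :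
  (k <= m)%N -> diff_ratio I xs = 1 ->
  (forall j, z j != xs j -> exists i, e i = j) ->
  x \in A -> ball d z \subset A ->
  cpa_ratios R m d k r -> r <= highest_ratio I x A.
Proof.
move=> km xs1 cover xA zA.
case=> N [Ns [/andP[Ns0 NsN]
  [[Psi Phi] /= [[sz _ low bal] sPsi _ cPhi]] ->]].
rewrite ler_pdivrMr ?ltr0n ?(leq_trans Ns0) //.
have leNs : Ns%:R <= \sum_(u <- Phi) diff_ratio I (hybrid e z xs u).
  rewrite -cPhi -sum1_count natr_sum big_mkcond; apply: ler_sum => u _.
  case: ifP => [/eqP->|_]; last exact: diff_ratio_ge0.
  by rewrite hybrid_ones // xs1.
apply: le_trans leNs _; rewrite -(sum_diff_ratio_hybrid km sz bal).
rewrite mulr_natr -sPsi -(count_predT Psi) -iter_addr_0 -big_const_seq.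
rewrite big_seq [leRHS]big_seq; apply: ler_sum => u uPsi.
apply: diff_ratio_le_highest => //; apply: (subsetP zA); rewrite inE.
by apply: leq_trans (hamming_hybrid u) (allP low u uPsi).
Qed.

End Hybrid.
End DiffRatio.

(** * Neighborhoods *)

Lemma mem_ball_center (q n d : nat) (x : solution q n) : x \in ball d x.
Proof.
rewrite inE /hamming (_ : [set _ | _] = set0) ?cards0 //.
by apply/setP => i; rewrite !inE eqxx.
Qed.

Lemma sub_shifted_ball (q n d : nat) (x : solution q n) (a : 'Z_q) :
  ball d (x + [ffun=> a]) \subset shifted_ball d x.
Proof. exact: (bigcup_sup a). Qed.

Lemma mem_shifted_ball_center (q n d : nat) (x : solution q n) :
  x \in shifted_ball d x.
Proof.
apply: (subsetP (sub_shifted_ball d x 0)).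
rewrite (_ : x + _ = x) ?mem_ball_center //.
by apply/ffunP => i; rewrite !ffunE addr0.
Qed.

(** Each coordinate agrees with [xs] for exactly one of the [q] shifts, hence
    some shift agrees with [xs] on at least the average number [n / q]. *)
Lemma close_shift (q n : nat) (x xs : solution q n) : (1 < q)%N ->
  exists a : 'Z_q, (hamming (x + [ffun=> a])%R xs <= n * (q - 1) %/ q)%N.
Proof.
move=> q1; pose agree (a : 'Z_q) := #|[set i | xs i - x i == a]|.
have sum_agree : (\sum_a agree a = n)%N.
  rewrite -[RHS]card_ord -sum1_card.
  rewrite (partition_big (fun i => xs i - x i) xpredT) //=.
  apply: eq_bigr => a _; rewrite /agree -sum1_card.
  by apply: eq_bigl => i; rewrite inE.
have cardZ : #|'Z_q| = q by rewrite card_ord Zp_cast.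
have [a aP] : exists a, (n <= q * agree a)%N.
  have [a _ a_max] := @arg_maxnP 'Z_q 0 xpredT agree isT.
  exists a; rewrite -sum_agree -[q in (q * _)%N]cardZ -sum_nat_const.
  by apply: leq_sum => b _; apply: a_max.
exists a; rewrite leq_divRL ?(ltnW q1) //.
have -> : hamming (x + [ffun=> a])%R xs = (n - agree a)%N.
  rewrite /hamming cardsCs card_ord; congr (_ - #|pred_of_set _|)%N.
  by apply/setP => i; rewrite !inE !ffunE negbK subr_eq addrC eq_sym.
by rewrite mulnBl mulnBr muln1 leq_sub2l // mulnC.
Qed.

Theorem theorem4p1 (R : realType) (q k d n : nat)
    (hq : (2 <= q)%N) (hk : (2 <= k)%N) (hd : (k <= d)%N)
    (I : csp R q k n) (hI : opt I != wor I) (x : solution q n) :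
  ((d <= n)%N -> delta R n d k <= highest_ratio I x (ball d x)) /\
  ((d <= n * (q - 1) %/ q)%N ->
     delta R (n * (q - 1) %/ q) d k <= highest_ratio I x (shifted_ball d x)).
Proof.
have [xs xs1] := diff_ratio_opt hI.
have attained m := proj1 (@delta_is_largest R m d k hd).
split=> [dn|dm].
  apply: (@cpa_ratio_le_highest _ _ _ _ I n id x xs _ d) => //.
  - exact: leq_trans hd dn.
  - by move=> j _; exists j.
  - exact: mem_ball_center.
have [a xa_close] := close_shift x xs hq.
set m := (n * (q - 1) %/ q)%N in dm xa_close *.
have mn : (m <= n)%N.
  apply: (@leq_trans (n * q %/ q)); last by rewrite mulnK // ltnW.
  by rewrite leq_div2r // leq_mul2l leq_subr orbT.
(* The columns are the coordinates where the shift differs from [xs], padded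
   to [m] coordinates. *)
have [|B diffB cB] :=
    @superset_of_card _ [set j | (x + [ffun=> a]) j != xs j] m.
  by rewrite card_ord mn andbT.
have [e [e_incr eB]] := enumerate_increasing cB.
apply: (@cpa_ratio_le_highest _ _ _ _ I m e (x + [ffun=> a]) xs _ d) => //.
- exact: increasing_inj e_incr.
- exact: leq_trans hd dm.
- by move=> j diff; apply: eB; apply: (subsetP diffB); rewrite inE.
- exact: mem_shifted_ball_center.
- exact: sub_shifted_ball.
Qed.
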